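(* The number $\frac{6}{121}\left(5\sqrt5-2\right)$ ($=0.4552\dots$) is a non-jump for $3$-graphs (i.e. it is not a jump for $3$-graphs).
   Context: For a set $S$, $S^{(r)}$ denotes the set of all $r$-element subsets of $S$. An $r$-graph ($r$-uniform hypergraph) is a pair $G=(V(G),E(G))$ with $V(G)$ finite and $E(G)\subseteq V(G)^{(r)}$. Its order is $|V(G)|$, and its density is $D(G)=|E(G)|/|V(G)^{(r)}|$. A number $\alpha\in[0,1)$ is a jump for $r$-graphs if there is $\delta=\delta(\alpha)>0$ such that for each $\varepsilon>0$ and each integer $n\geq r$, any sufficiently large $r$-graph (i.e. of order at least some $N=N(\varepsilon,n)$) of density at least $\alpha+\varepsilon$ has a subgraph of order $n$ and density at least $\alpha+\delta$. Otherwise $\alpha\in[0,1)$ is a non-jump for $r$-graphs. *)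

(* Defs.v *)
From HB Require Import structures.
From mathcomp Require Import all_boot all_order all_algebra.
From mathcomp Require Import reals.

Set Implicit Arguments.
Unset Strict Implicit.
Unset Printing Implicit Defensive.

Import Order.TTheory GRing.Theory Num.Theory.
Local Open Scope ring_scope.

(* S^(r) *)
Definition rsubsets (T : finType) (S : {set T}) (r : nat) : {set {set T}} :=
  [set e : {set T} | (e \subset S) && (#|e| == r)].

(* The vertex set is an arbitrary subset of an ambient finite type [T], so that
   a graph and its subgraphs live over the same [T]; statements about all
   r-graphs quantify over [T] as well. *)
Record rgraph (T : finType) (r : nat) := RGraph {
  vertices : {set T};
  edges : {set {set T}};
  edgesP : edges \subset rsubsets vertices r
}.

Definition graph_order (T : finType) (r : nat) (G : rgraph T r) : nat :=
  #|vertices G|.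

(* When [graph_order G < r] the quotient is 0 / 0 = 0. *)
Definition density (R : realType) (T : finType) (r : nat) (G : rgraph T r) : R :=
  #|edges G|%:R / #|rsubsets (vertices G) r|%:R.

(* Not necessarily induced. *)
Definition subgraph (T : finType) (r : nat) (H G : rgraph T r) : Prop :=
  (vertices H \subset vertices G) /\ (edges H \subset edges G).

Definition jump (R : realType) (r : nat) (alpha : R) : Prop :=
  0 <= alpha < 1 /\
  exists delta : R, 0 < delta /\
    forall (eps : R) (n : nat), 0 < eps -> (r <= n)%N ->
    exists N : nat, forall (T : finType) (G : rgraph T r),
      (N <= graph_order G)%N -> alpha + eps <= density R G ->
      exists H : rgraph T r,
        [/\ subgraph H G, graph_order H = n & alpha + delta <= density R H].

Definition non_jump (R : realType) (r : nat) (alpha : R) : Prop :=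
  0 <= alpha < 1 /\ ~ jump r alpha.

(* Main.v *)
Require Import Defs.
From mathcomp Require Import all_boot all_order all_algebra.
From mathcomp Require Import reals.
From mathcomp Require Import ring lra zify.

Set Implicit Arguments.
Unset Strict Implicit.
Unset Printing Implicit Defensive.

Import Order.TTheory GRing.Theory Num.Theory.
Local Open Scope ring_scope.

(** Let [F(y) = y (1 - y)^2 / 2 + ((1 - 2 y) / 3)^3], whose maximum over [0, 1/2]
   is [(5 sqrt 5 - 2) / 121], attained at [y = (10 - 3 sqrt 5) / 11].  This
   maximum is the Lagrangian of the pattern on layers 0, 1, 2, 3 of weights
   [y, s, a, b] whose edges are the 0ww' with [w], [w'] outside layer 0 and not
   one in layer 2 and the other in layer 3, together with the edges 123: these
   choices gain [(s - y) a b] over [y (1 - y)^2 / 2], to which AM-GM applies.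

   Insert into layer 2 a 3-graph [H] on [N] vertices with [20 N^2] edges in which
   every set of [v <= m] vertices spans at most [v - 2] edges.  Then the
   Lagrangian exceeds the maximum of [F].  But on at most [m] vertices it does
   not: if [p], [q] are the two largest of the weights [x_i] in layer 2, whose
   sum is [a], Abel summation bounds the contribution of [H] by
   [x_p x_q (a - x_p - x_q)]; as the pairs inside a vertex of layer 2 are missing
   from the links of layer 0, the net gain is at most
   [x_p x_q (a - y - x_p - x_q) <= ((a - y)^+ / 3)^3], and the
   total stays below the maximum of [F].  Blowing up these patterns, following
   Frankl and Rodl, shows that [6 max F] is a non-jump. *)

(** * Locally sparse triple systems *)

Definition within (T : finType) (S : {set T}) (t : T * T * T) : bool :=
  [&& t.1.1 \in S, t.1.2 \in S & t.2 \in S].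

Lemma withinS (T : finType) (A B : {set T}) (t : T * T * T) :
  A \subset B -> within A t -> within B t.
Proof. by move=> /subsetP AB /and3P[a b c]; apply/and3P; split; apply: AB. Qed.

Lemma card_within (T : finType) (S : {set T}) :
  #|[set t | within S t]| = (#|S| ^ 3)%N.
Proof.
rewrite (_ : [set t | within S t] = setX (setX S S) S); last first.
  by apply/setP=> t; rewrite !inE /within andbA.
by rewrite !cardsX !expnS expn0 muln1 mulnA.
Qed.

Lemma card_ffun_within (N E : nat) (S : {set 'I_N}) (J : {set 'I_E}) :
  #|[set f : {ffun 'I_E -> 'I_N * 'I_N * 'I_N}
       | [forall j in J, within S (f j)]]|
  = ((#|S| ^ 3) ^ #|J| * (N ^ 3) ^ (E - #|J|))%N.
Proof.
pose F (j : 'I_E) := [pred t : 'I_N * 'I_N * 'I_N | (j \in J) ==> within S t].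
rewrite (_ : [set _ | _] = [set f in family F]); last first.
  by apply/setP=> f; rewrite !inE; apply: eq_forallb => j.
rewrite cardsE card_family foldrE big_image /=.
rewrite (bigID (mem J)) /=; congr (_ * _)%N.
  rewrite -prod_nat_const; apply: eq_bigr => j jJ.
  rewrite -card_within cardsE; apply: eq_card => t.
  by rewrite -[LHS]/((j \in J) ==> within S t) jJ.
have -> : (E - #|J| = #|~: J|)%N by rewrite [RHS]cardsCs setCK card_ord.
rewrite -prod_nat_const; apply: eq_big => [j|j /negbTE jJ]; first by rewrite /= in_setC.
transitivity #|{: 'I_N * 'I_N * 'I_N}|.
  by apply: eq_card => t; rewrite -[LHS]/((j \in J) ==> within S t) jJ.
by rewrite !card_prod !card_ord !expnS expn0 muln1 mulnA.
Qed.

Lemma leq_bin_expn (n k : nat) : ('C(n, k) <= n ^ k)%N.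
Proof.
apply: leq_trans (_ : n ^_ k <= _)%N.
  by rewrite -bin_ffact leq_pmulr ?fact_gt0.
elim: k => [|k IH]; first by rewrite ffactn0.
by rewrite ffactnSr expnSr leq_mul ?leq_subr.
Qed.

Lemma exists_le_average (T : finType) (F : T -> nat) (c : nat) :
  (0 < #|T|)%N -> (\sum_t F t <= #|T| * c)%N -> exists t, (F t <= c)%N.
Proof.
move=> T0 le; apply/existsP; apply: contraLR le => /existsPn gt.
rewrite -ltnNge -sum_nat_const.
have /card_gt0P[t0 _] := T0.
rewrite [ltnLHS](bigD1 t0) //= [ltnRHS](bigD1 t0) //= -addSn leq_add //.
  by rewrite ltnNge gt.
by apply: leq_sum => t _; rewrite ltnW // ltnNge gt.
Qed.

(** The least number of triples that violates the bound [v - 2]. *)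
Definition excess (v : nat) : nat := (v - 2).+1.

(** The index set is a witness of exact size, so that for a fixed pair the families [f] form a
    product; a vertex set may be counted with several witnesses. *)
Definition dense_sets (N E M : nat) (f : {ffun 'I_E -> 'I_N * 'I_N * 'I_N}) :=
  [set c : {set 'I_N} * {set 'I_E} |
    [&& (#|c.1| <= M)%N, #|c.2| == excess #|c.1|
      & [forall j in c.2, within c.1 (f j)]]].

(** First moment, with the sums exchanged. For [v] vertices and [d = excess v] indices there are at
    most [N ^ v * (K * N ^ 2) ^ d] pairs, each dense for a fraction [(v / N) ^ (3 * d)] of the
    families; as [v <= d + 1], at most one power of [N] remains. *)
Lemma sum_card_dense_sets (N K M : nat) (E := (K * N ^ 2)%N) :
  (0 < N)%N ->
  (\sum_(f : {ffun 'I_E -> 'I_N * 'I_N * 'I_N}) #|dense_sets M f|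
   <= (N ^ 3) ^ E * (\sum_(v < M.+1) K ^ excess v * (v ^ 3) ^ excess v * N))%N.
Proof.
move=> N0; pose d := excess.
have -> : (\sum_(f : {ffun 'I_E -> 'I_N * 'I_N * 'I_N}) #|dense_sets M f| =
     \sum_(c : {set 'I_N} * {set 'I_E} | (#|c.1| <= M) && (#|c.2| == d #|c.1|))
      (#|c.1| ^ 3) ^ #|c.2| * (N ^ 3) ^ (E - #|c.2|))%N.
  under eq_bigr do rewrite -sum1_card.
  rewrite (exchange_big_dep (fun c : {set 'I_N} * {set 'I_E} =>
    (#|c.1| <= M)%N && (#|c.2| == d #|c.1|))) /=; last first.
    by move=> f c _; rewrite inE andbA => /andP[].
  apply: eq_bigr => c /andP[c1 c2]; rewrite sum1_card -card_ffun_within.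
  rewrite -[RHS]cardsE; apply: eq_card => f.
  by rewrite -[LHS]/(c \in dense_sets M f) !inE c1 c2.
rewrite (partition_big (fun c : {set 'I_N} * {set 'I_E} => inord #|c.1| : 'I_M.+1)
  xpredT) //= big_distrr /=; apply: leq_sum => v _.
rewrite (eq_bigl (mem (setX [set S : {set 'I_N} | S \subset setT & #|S| == v]
   [set J : {set 'I_E} | J \subset setT & #|J| == d v]))); last first.
  case=> S J; rewrite !inE !subsetT /=.
  apply/andP/andP => [[/andP[SM /eqP ->] /eqP <-]|[/eqP -> /eqP ->]].
    by rewrite inordK.
  by rewrite eqxx -ltnS ltn_ord; split=> //; apply/eqP/val_inj; rewrite /= inordK.
rewrite (eq_bigr (fun _ => (v ^ 3) ^ d v * (N ^ 3) ^ (E - d v))%N); last first.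
  by case=> S J; rewrite !inE !subsetT => /andP[/eqP/= -> /eqP ->].
rewrite sum_nat_const cardsX !cards_draws !cardsT !card_ord.
have [dE|dE] := leqP (d v) E; last by rewrite (bin_small dE) muln0.
have vd : (v <= (d v).+1)%N by rewrite /d /excess; lia.
apply: leq_trans (_ : N ^ (d v).+1 * E ^ d v *
   ((v ^ 3) ^ d v * (N ^ 3) ^ (E - d v)) <= _)%N.
  rewrite leq_mul // leq_mul ?leq_bin_expn //.
  by apply: leq_trans (leq_bin_expn _ _) _; rewrite leq_pexp2l.
rewrite -{3}(subnK dE) {1}/E expnMn expnD -!expnM expnS.
rewrite [X in (_ <= X)%N](_ : _ = N * N ^ d v * (K ^ d v * N ^ (2 * d v)) *
  (v ^ (3 * d v) * N ^ (3 * (E - d v))))%N //.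
rewrite (_ : (3 * d v = d v + 2 * d v)%N); last by lia.
rewrite !expnD; ring.
Qed.

(* Deletion method: a set [S] is bad for the random family [f] when it contains
   more than [#|S| - 2] of the triples [f j].  On average there are [O(N)] bad
   sets, against [(K + 1) N ^ 2] triples.  Truncated subtraction makes the sets
   with at most one vertex fit the same pattern, and the bound for [#|S| <= 3]
   forces the surviving triples to be distinct with distinct entries. *)
Lemma exists_locally_sparse (m K : nat) :
  exists (N : nat) (H : {set 'I_N * 'I_N * 'I_N}),
    [/\ (0 < N)%N, (K * N ^ 2 <= #|H|)%N &
      forall S : {set 'I_N}, (#|S| <= m)%N ->
        (#|[set t in H | within S t]| <= #|S| - 2)%N].
Proof.
pose M := (m + 3)%N.
pose C := (\sum_(v < M.+1) K.+1 ^ excess v * (v ^ 3) ^ excess v)%N.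
(* Since [N > C], the extra [N ^ 2] triples beyond [K * N ^ 2] pay for the at most [C * N]
   deletions. *)
pose N := C.+1; pose E := (K.+1 * N ^ 2)%N.
pose I := ('I_N * 'I_N * 'I_N)%type.
have [||f dense_f] := @exists_le_average {ffun 'I_E -> I} (fun f => #|dense_sets M f|) (C * N).
- by apply/card_gt0P; exists [ffun=> (ord0, ord0, ord0)].
- apply: leq_trans (sum_card_dense_sets K.+1 M (ltn0Sn C)) _.
  rewrite card_ffun !card_prod !card_ord -big_distrl /=.
  by rewrite (_ : N * N * N = N ^ 3)%N // !expnS expn0 muln1 mulnA.
pose R := [set j | [exists c in dense_sets M f, [pick i in c.2] == Some j]].
have cardR : (#|R| <= C * N)%N.
  apply: leq_trans dense_f.
  pose g (c : {set 'I_N} * {set 'I_E}) := [pick i in c.2].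
  rewrite -(card_imset _ (@Some_inj _)) (leq_trans _ (leq_imset_card g _)) //.
  apply/subset_leq_card/subsetP=> _ /imsetP[j + ->].
  by rewrite inE => /exists_inP[c cb /eqP <-]; apply: imset_f.
(* Otherwise some witness among the surviving indices would have had its picked index deleted. *)
have sparse (S : {set 'I_N}) : (#|S| <= M)%N ->
    (#|[set j in ~: R | within S (f j)]| <= #|S| - 2)%N.
  move=> SM; rewrite leqNgt; apply/negP => gt.
  have [J /andP[JS /eqP cJ]] : exists J : {set 'I_E},
      (J \subset [set j in ~: R | within S (f j)]) && (#|J| == excess #|S|).
    have: (0 < 'C(#|[set j in ~: R | within S (f j)]|, excess #|S|))%N by rewrite bin_gt0.
    by rewrite -cards_draws => /card_gt0P[J]; rewrite inE; exists J.
  have Jbad : (S, J) \in dense_sets M f.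
    rewrite inE /= SM cJ eqxx; apply/forall_inP=> j /(subsetP JS).
    by rewrite inE => /andP[].
  have : [pick i in J] != None.
    case: pickP => // J0; move: cJ; rewrite (_ : J = set0) ?cards0 //.
    by apply/setP=> j; rewrite !inE J0.
  case E0: [pick i in J] => [j|] // _.
  have /(subsetP JS) : j \in J by case: pickP E0 => // ? ? [<-].
  rewrite !inE => /andP[/negP[]]; apply/existsP; exists (S, J).
  by rewrite Jbad E0 /=.
have inj : {in ~: R &, injective f}.
  move=> i j iR jR fij; apply/eqP; apply: contraT => nij.
  pose S := [set (f i).1.1; (f i).1.2; (f i).2].
  have S3 : (#|S| <= 3)%N.
    rewrite /S; apply: leq_trans (leq_card_setU _ _) _.
    by rewrite cards1 cards2; case: eqP.
  have := sparse S (leq_trans S3 (leq_addl _ _)).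
  rewrite leqNgt => /negP[]; apply: (@leq_trans #|[set i; j]|).
    by rewrite cards2 nij ltnS leq_subLR.
  apply/subset_leq_card/subsetP => k; rewrite in_set2 => /orP[] /eqP ->.
    by rewrite in_set iR /within !inE !eqxx !orbT.
  by rewrite in_set jR /within -fij !inE !eqxx !orbT.
exists N, (f @: ~: R); split=> //.
  rewrite card_in_imset // cardsCs setCK card_ord.
  have RN : (#|R| <= N ^ 2)%N by rewrite (leq_trans cardR) // expnS expn1 leq_mul.
  apply: leq_trans (_ : E - N ^ 2 <= _)%N; last exact: leq_sub2l.
  by rewrite /E mulSn addKn.
move=> S Sm; apply: leq_trans (sparse S (leq_trans Sm (leq_addr _ _))).
apply: leq_trans (leq_imset_card f _); apply/subset_leq_card/subsetP => t.
rewrite inE => /andP[/imsetP[j jR ->] jS]; apply: imset_f.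
by rewrite inE jR.
Qed.

(** * Lagrangians of locally sparse systems *)

Definition sparse_on (T : finType) (H : {set T * T * T}) (S : {set T}) : Prop :=
  forall A : {set T}, A \subset S ->
    (#|[set t in H | within A t]| <= #|A| - 2)%N.

Lemma sparse_on_within (T : finType) (H : {set T * T * T}) (S A : {set T})
    (t : T * T * T) :
  sparse_on H S -> A \subset S -> t \in H -> within A t -> (2 < #|A|)%N.
Proof.
move=> sp AS tH tA; rewrite -subn_gt0; apply: leq_trans (sp A AS).
by apply/card_gt0P; exists t; rewrite inE tH.
Qed.

(** A repeated entry would leave the triple inside two vertices, which span no triple. *)
Lemma sparse_on_distinct (T : finType) (H : {set T * T * T}) (S : {set T})
    (t : T * T * T) :
  sparse_on H S -> t \in H -> within S t ->
  [&& t.1.1 != t.1.2, t.1.1 != t.2 & t.1.2 != t.2].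
Proof.
move=> sp tH /and3P[t1 t2 t3]; apply: contraT => nd.
have sub i j : i \in S -> j \in S -> [set i; j] \subset S.
  by move=> iS jS; apply/subsetP => k; rewrite inE => /orP[] /set1P ->.
have bound i j : i \in S -> j \in S -> within [set i; j] t -> False.
  move=> iS jS /(sparse_on_within sp (sub _ _ iS jS) tH).
  by rewrite cards2; case: eqP.
move: nd; rewrite !negb_and !negbK => /or3P[] /eqP e.
- by case: (bound t.1.1 t.2) => //; rewrite /within -e !inE !eqxx !orbT.
- by case: (bound t.1.1 t.1.2) => //; rewrite /within -e !inE !eqxx !orbT.
- by case: (bound t.1.1 t.1.2) => //; rewrite /within -e !inE !eqxx !orbT.
Qed.

Definition min3 (R : realFieldType) (T : Type) (x : T -> R) (t : T * T * T) : R :=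
  Num.min (x t.1.1) (Num.min (x t.1.2) (x t.2)).

(* Abel summation: removing a lightest vertex [w] and subtracting [x w] from all
   weights changes both sides by at most [(#|S| - 2) * x w]. *)
Lemma sum_min3_le (R : realFieldType) (T : finType) (H : {set T * T * T})
    (S : {set T}) (x : T -> R) :
  (1 < #|S|)%N -> sparse_on H S -> (forall i, i \in S -> 0 <= x i) ->
  exists p q, [/\ p \in S, q \in S, p != q,
    forall i, i \in S -> i != p -> i != q -> x i <= x p /\ x i <= x q &
    \sum_(t in H | within S t) min3 x t <= \sum_(i in S) x i - x p - x q].
Proof.
have [n] := ubnP #|S|; elim: n => // n IH in S x *; rewrite ltnS => Sn S2 sp x0.
have [S3|] := ltnP 2 #|S|; last first.
  move=> S2'; have /cards2P[p [q [pq SE]]] : #|S| == 2 by rewrite eqn_leq S2' S2.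
  exists p, q; split=> //; rewrite ?SE ?inE ?eqxx ?orbT //.
    by move=> i; rewrite !inE => /orP[] ->.
  rewrite big_pred0 => [|t]; last first.
    apply/negP => /andP[tH tS].
    by have := sparse_on_within sp (subxx _) tH; rewrite SE tS ltnNge -SE S2' => /(_ isT).
  by rewrite big_setU1 ?inE //= big_set1; lra.
have [i0 i0S] : exists i, i \in S by apply/card_gt0P; lia.
pose w := [arg min_(i < i0 in S) x i]%O.
have [wS wmin] : w \in S /\ forall i, i \in S -> x w <= x i.
  by rewrite /w; case: arg_minP.
have cS : #|S| = (#|S :\ w|).+1 by rewrite (cardsD1 w) wS.
have subS : S :\ w \subset S by apply: subD1set.
have [||A AS|i|p [q [pS qS pq top le]]] := IH (S :\ w) (fun i => x i - x w).
- by rewrite -ltnS -cS.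
- by rewrite -ltnS -cS.
- by apply: sp; apply: subset_trans AS _.
- by rewrite inE subr_ge0 => /andP[_ /wmin].
exists p, q; split; rewrite ?(subsetP subS) //.
  move=> i iS ip iq; have [->|iw] := eqVneq i w.
    by split; apply: wmin; apply: (subsetP subS).
  by have := top i; rewrite !inE iw iS !lerD2r => /(_ isT ip iq).
(* A triple avoiding [w] loses exactly [x w]; one through [w] had minimum at most [x w] and now
   counts as 0. *)
have : \sum_(t in H | within S t) min3 x t <=
   \sum_(t in H | within (S :\ w) t) min3 (fun i => x i - x w) t
     + #|[set t in H | within S t]|%:R * x w.
  rewrite mulr_natl -sumr_const.
  rewrite [X in _ <= _ + X](eq_bigl (fun t => (t \in H) && within S t)); last first.
    by move=> t; rewrite inE.
  rewrite [X in _ <= X + _](_ : _ =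
      \sum_(t in H | within S t) if within (S :\ w) t
        then min3 (fun i => x i - x w) t else 0); last first.
    rewrite -big_mkcondr; apply: eq_bigl => t.
    by rewrite -andbA; case tw: (within (S :\ w) t); rewrite ?andbF // (withinS subS tw).
  rewrite -big_split; apply: ler_sum => t /andP[tH /and3P[t1 t2 t3]] /=.
  case: ifPn => [_|].
    by rewrite /min3 -!addr_minl subrK.
  rewrite /within !inE t1 t2 t3 !andbT add0r !negb_and !negbK /min3.
  by move=> /or3P[] /eqP <-; rewrite !ge_min lexx ?orbT.
have -> : \sum_(i in S) x i = x w + \sum_(i in S :\ w) x i.
  by rewrite (big_setD1 w).
have card_le : #|[set t in H | within S t]|%:R * x w <= (#|S :\ w|%:R - 1) * x w.
  apply: ler_wpM2r; first exact: x0.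
  rewrite -[1]/(1%:R) -natrB; last by rewrite -ltnS -cS (leq_trans _ S3).
  by rewrite ler_nat (leq_trans (sp S (subxx _))) // cS; lia.
move: le card_le; rewrite sumrB sumr_const -mulr_natl mulrBl mul1r.
lra.
Qed.

Lemma amgm3 (R : realFieldType) (u v w : R) :
  0 <= u -> 0 <= v -> 0 <= w -> u * v * w <= ((u + v + w) / 3) ^+ 3.
Proof.
move=> u0 v0 w0; rewrite -subr_ge0.
have -> : ((u + v + w) / 3) ^+ 3 - u * v * w =
  ((u + v + w) / 2 * ((u - v) ^+ 2 + (v - w) ^+ 2 + (u - w) ^+ 2)
   + 3 * (u * (v - w) ^+ 2 + v * (u - w) ^+ 2 + w * (u - v) ^+ 2)) / 27 by field.
by rewrite !(sqr_ge0, addr_ge0, mulr_ge0, invr_ge0).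
Qed.

(** The squares are the loss in the links of layer 0. The bound [c] stands for the positive part of
    the layer weight minus [y], and is later taken to be 0 or that difference. *)
Lemma sparse_lagrangian_le (R : realFieldType) (T : finType)
    (H : {set T * T * T}) (x : T -> R) (y c : R) :
  (forall i, 0 <= x i) -> sparse_on H [set i | x i != 0] ->
  0 <= y -> 0 <= c -> \sum_i x i <= y + c ->
  \sum_(t in H) x t.1.1 * x t.1.2 * x t.2 - y / 2 * \sum_i x i ^+ 2
    <= (c / 3) ^+ 3.
Proof.
move=> x0 sp y0 c0 le_yc; set S := [set i | x i != 0].
have Q0 : 0 <= \sum_i x i ^+ 2 by apply: sumr_ge0 => i _; rewrite sqr_ge0.
have c3 : 0 <= (c / 3) ^+ 3 by rewrite exprn_ge0 // divr_ge0.
have -> : \sum_(t in H) x t.1.1 * x t.1.2 * x t.2 =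
    \sum_(t in H | within S t) x t.1.1 * x t.1.2 * x t.2.
  rewrite [RHS]big_mkcondr; apply: eq_bigr => t _; case: ifPn => //.
  by rewrite /within !inE !negb_and !negbK => /or3P[] /eqP ->; rewrite ?(mul0r, mulr0).
have [S2|S2] := ltnP 1 #|S|; last first.
  rewrite big_pred0.
    by rewrite sub0r lerNl (le_trans _ (mulr_ge0 _ Q0)) ?oppr_le0 ?divr_ge0.
  move=> t; apply/negP => /andP[tH tS].
  by have := sparse_on_within sp (subxx _) tH tS; rewrite ltnNge ltnW.
have [//|p [q [pS qS pq top le]]] := sum_min3_le S2 sp (x := x).
(* So the product over a triple is at most [x p * x q] times its least weight. *)
have top2 i j : i \in S -> j \in S -> i != j -> x i * x j <= x p * x q.
  move=> iS jS ij; have [ip|ip] := eqVneq i p.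
    have [->|jq] := eqVneq j q; first by rewrite ip.
    rewrite ip ler_wpM2l //; apply: (top j jS _ jq).2.
    by rewrite -ip eq_sym.
  have [iq|iq] := eqVneq i q.
    have [->|jp] := eqVneq j p; first by rewrite iq mulrC.
    rewrite iq mulrC ler_wpM2r //; apply: (top j jS jp _).1.
    by rewrite -iq eq_sym.
  have [ixp ixq] := top i iS ip iq.
  have [->|jp] := eqVneq j p; first by rewrite mulrC ler_wpM2l.
  have [->|jq] := eqVneq j q; first by rewrite ler_wpM2r.
  by rewrite ler_pM // (top j jS jp jq).2.
have g_le : \sum_(t in H | within S t) x t.1.1 * x t.1.2 * x t.2 <=
    x p * x q * \sum_(t in H | within S t) min3 x t.
  rewrite mulr_sumr; apply: ler_sum => t /andP[tH tS].
  have /and3P[d12 d13 d23] := sparse_on_distinct sp tH tS.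
  move: tS => /and3P[t1 t2 t3].
  rewrite /min3; case: (lerP (x t.1.2)) => _; case: (lerP (x t.1.1)) => _.
  - by rewrite -mulrA mulrC ler_wpM2r // top2.
  - by rewrite mulrAC ler_wpM2r // top2.
  - by rewrite -mulrA mulrC ler_wpM2r // top2.
  - by rewrite ler_wpM2r // top2.
have Qpq : x p ^+ 2 + x q ^+ 2 <= \sum_i x i ^+ 2.
  rewrite (bigD1 p) //= (bigD1 q) 1?eq_sym //= addrA lerDl.
  by apply: sumr_ge0 => i _; rewrite sqr_ge0.
have a_le : \sum_(i in S) x i <= y + c.
  apply: le_trans le_yc; rewrite [leRHS](bigID (mem S)) /= lerDl.
  by apply: sumr_ge0.
have xp0 := x0 p; have xq0 := x0 q.
set g := \sum_(t in H | _) _ in g_le *; set mn := \sum_(t in H | _) _ in g_le le.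
set Q := \sum_i _ in Q0 Qpq *; set a := \sum_(i in S) _ in a_le le.
have pq0 : 0 <= x p * x q by apply: mulr_ge0.
have step1 : g <= x p * x q * (y + c - x p - x q).
  by apply: le_trans g_le _; rewrite ler_wpM2l //; lra.
have step2 : y / 2 * (x p ^+ 2 + x q ^+ 2) <= y / 2 * Q by rewrite ler_wpM2l ?divr_ge0.
(* Two weights multiply to at most half the sum of their squares; this turns [y + c] into [c]. *)
have step3 : y * (x p * x q) <= y / 2 * (x p ^+ 2 + x q ^+ 2).
  have := mulr_ge0 y0 (sqr_ge0 (x p - x q)); nra.
have [z0|z0] := lerP 0 (c - x p - x q); last first.
  have : x p * x q * (c - x p - x q) <= 0 by rewrite mulr_ge0_le0 // ltW.
  lra.
suff : x p * x q * (c - x p - x q) <= (c / 3) ^+ 3 by lra.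
apply: le_trans (amgm3 xp0 xq0 z0) _.
by rewrite (_ : x p + x q + (c - x p - x q) = c) //; ring.
Qed.

(** * Blow-ups *)

Definition triple_set (T : finType) (t : T * T * T) : {set T} :=
  [set t.1.1; t.1.2; t.2].

Definition map3 (S T : Type) (f : S -> T) (t : S * S * S) : T * T * T :=
  (f t.1.1, f t.1.2, f t.2).

(* An ordered triple stands for its underlying 3-set; this says that every
   3-set is represented by at most one triple. *)
Definition represents_3graph (P : finType) (G : {set P * P * P}) : Prop :=
  {in G &, injective (@triple_set P)} /\ {in G, forall t, #|triple_set t| = 3}.

Definition lagrangian (R : realFieldType) (P : finType) (G : {set P * P * P})
    (x : P -> R) : R :=
  \sum_(t in G) x t.1.1 * x t.1.2 * x t.2.

Lemma card_triple_set (T : finType) (t : T * T * T) :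
  #|triple_set t| = 3 -> [/\ t.1.1 != t.1.2, t.1.1 != t.2 & t.1.2 != t.2].
Proof.
rewrite /triple_set setUC cardsU1 cards2 !inE.
rewrite !(eq_sym t.2).
by case: (t.1.1 == t.1.2); case: (t.1.1 == t.2); case: (t.1.2 == t.2).
Qed.

Lemma card_triple_set_uniq (T : finType) (t : T * T * T) :
  t.1.1 != t.1.2 -> t.1.1 != t.2 -> t.1.2 != t.2 -> #|triple_set t| = 3.
Proof.
move=> n12 n13 n23; rewrite /triple_set setUC cardsU1 cards2 !inE n12.
by rewrite !(eq_sym t.2) (negbTE n13) (negbTE n23).
Qed.

Lemma triple_set_sub (T : finType) (t : T * T * T) (S : {set T}) :
  (triple_set t \subset S) = within S t.
Proof. by rewrite /triple_set !subUset !sub1set -andbA. Qed.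

Section Blowup.
Variables (P T : finType) (k : T -> P) (G : {set P * P * P}).

Definition blowup (U : {set T}) : {set T * T * T} :=
  [set t | (map3 k t \in G) && within U t].

Lemma card_blowup (U : {set T}) (n := fun p => #|[set v in U | k v == p]|) :
  #|blowup U| = (\sum_(t in G) n t.1.1 * n t.1.2 * n t.2)%N.
Proof.
rewrite -sum1_card (partition_big (map3 k) (mem G)) /=; last first.
  by move=> t; rewrite inE => /andP[].
apply: eq_bigr => -[[p q] r] pqrG /=; rewrite -!cardsX -sum1_card.
apply: eq_bigl => -[[u v] w]; rewrite !inE /within /map3 /= !xpair_eqE.
apply/idP/idP.
  by case/and3P=> /andP[_ /and3P[-> -> ->]] /andP[-> ->] ->.
by case/andP=> /andP[/andP[-> /eqP->] /andP[-> /eqP->]] /andP[-> /eqP->]; rewrite pqrG !eqxx.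
Qed.

Hypothesis GP : represents_3graph G.

Lemma blowup_card3 (U : {set T}) (t : T * T * T) :
  t \in blowup U -> #|triple_set t| = 3.
Proof.
rewrite inE => /andP[/GP.2 /card_triple_set[n12 n13 n23] _].
by apply: card_triple_set_uniq;
  [apply: contra_neq n12 | apply: contra_neq n13 | apply: contra_neq n23] => /= ->.
Qed.

Lemma imset_triple_set (t : T * T * T) :
  k @: triple_set t = triple_set (map3 k t).
Proof. by rewrite /triple_set !imsetU !imset_set1. Qed.

(** Equal vertex sets have equal images under [k], so the images agree as ordered triples; their
    entries being distinct, [k] determines the position of each vertex. *)
Lemma triple_set_blowup_inj (U : {set T}) :
  {in blowup U &, injective (@triple_set T)}.
Proof.
move=> s t; rewrite !inE => /andP[sG _] /andP[tG _] st.
have : map3 k s = map3 k t by apply: GP.1 => //; rewrite -!imset_triple_set st.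
have [n12 n13 n23] := card_triple_set (GP.2 _ sG).
case=> e1 e2 e3.
have : within (triple_set t) s by rewrite -triple_set_sub st.
case: s t {st sG tG} e1 e2 e3 n12 n13 n23 => [[a b] c] [[a' b'] c'] /=.
rewrite /within !inE /= => e1 e2 e3 /eqP n12 /eqP n13 /eqP n23.
by case/and3P=> /orP[/orP[]|] /eqP ea /orP[/orP[]|] /eqP eb /orP[/orP[]|] /eqP ec;
  congruence.
Qed.

Definition blowup_graph (U : {set T}) : Defs.rgraph T 3.
Proof.
apply: (@RGraph T 3 U [set triple_set t | t in blowup U]).
apply/subsetP => _ /imsetP[t tU ->]; rewrite inE (blowup_card3 tU) eqxx andbT.
by rewrite triple_set_sub; move: tU; rewrite inE => /andP[].
Defined.

Lemma card_blowup_edges (U : {set T}) : #|edges (blowup_graph U)| = #|blowup U|.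
Proof. by rewrite /= card_in_imset //; apply: triple_set_blowup_inj. Qed.

Lemma card_subgraph_blowup (U : {set T}) (H : Defs.rgraph T 3) :
  subgraph H (blowup_graph U) -> (#|edges H| <= #|blowup (vertices H)|)%N.
Proof.
move=> [_ /subsetP HE]; rewrite -card_blowup_edges.
apply/subset_leq_card/subsetP => e eH.
have /subsetP/(_ e eH) := edgesP H; rewrite inE => /andP[+ _].
have /imsetP[t + ->] := HE e eH; rewrite triple_set_sub => tU tH.
by apply: imset_f; move: tU; rewrite !inE tH => /andP[->].
Qed.

End Blowup.

(** * Densities of blow-ups and a criterion for non-jumps *)

Lemma bin3_mul6 (n : nat) : ('C(n, 3) * 6 = n * n.-1 * n.-2)%N.
Proof. by rewrite -[6%N]/(3`!) bin_ffact !ffactnS ffactn0 muln1 mulnA. Qed.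

Lemma density3E (R : realType) (T : finType) (G : Defs.rgraph T 3) :
  density R G = #|edges G|%:R / 'C(graph_order G, 3)%:R.
Proof. by rewrite /density /rsubsets cards_draws. Qed.

Lemma lagrangianZ (R : realFieldType) (P : finType) (G : {set P * P * P})
    (c : R) (x : P -> R) :
  lagrangian G (fun p => c * x p) = c ^+ 3 * lagrangian G x.
Proof. by rewrite /lagrangian mulr_sumr; apply: eq_bigr => t _; ring. Qed.

Lemma sum_card_fibers (P T : finType) (k : T -> P) (U : {set T}) :
  (\sum_p #|[set v in U | k v == p]| = #|U|)%N.
Proof.
rewrite -[RHS]sum1_card (partition_big k xpredT) //=; apply: eq_bigr => p _.
by rewrite -sum1_card; apply: eq_bigl => v; rewrite inE.
Qed.

(** Give each class its share of the vertices of [H]: at most [m] classes are nonempty, and the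
    edges of [H] number at most [m ^ 3] times the Lagrangian. *)
Lemma card_subgraph_blowup_le (R : realFieldType) (P T : finType) (k : T -> P)
    (G : {set P * P * P}) (GP : represents_3graph G) (U : {set T})
    (H : Defs.rgraph T 3) (m : nat) (l : R) :
  (forall u : P -> R, (forall p, 0 <= u p) -> \sum_p u p = 1 ->
     (#|[set p | u p != 0%R]| <= m)%N -> lagrangian G u <= l) ->
  subgraph H (blowup_graph k GP U) -> graph_order H = m -> (0 < m)%N ->
  #|edges H|%:R <= l * m%:R ^+ 3.
Proof.
move=> Gl HG Hm m0; set V := vertices H.
have mR : 0 < m%:R :> R by rewrite ltr0n.
pose n p := #|[set v in V | k v == p]|.
have sum_n : (\sum_p n p = m)%N by rewrite sum_card_fibers.
pose u p : R := m%:R^-1 * (n p)%:R.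
have := Gl u; rewrite /u lagrangianZ exprVn -mulr_sumr -natr_sum sum_n.
rewrite mulVf ?gt_eqF // => Gu.
have {Gu} : (m%:R ^+ 3)^-1 * lagrangian G (fun p => (n p)%:R) <= l.
  apply: Gu => [p||] //; first by rewrite mulr_ge0 // invr_ge0.
  rewrite -sum_n -sum1_card big_mkcond; apply: leq_sum => p _.
  by rewrite inE; case: (n p) => [|n']; rewrite ?mulr0 ?eqxx //; case: ifP.
rewrite mulrC ler_pdivrMr ?exprn_gt0 // => nl; apply: le_trans nl.
apply: le_trans (_ : #|blowup k G V|%:R <= _).
  by rewrite ler_nat; apply: card_subgraph_blowup HG.
rewrite card_blowup natr_sum /lagrangian le_eqVlt; apply/orP; left.
by apply/eqP; apply: eq_bigr => t _; rewrite !natrM.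
Qed.

(** Serves to round class sizes down to integers: the factors are replaced one at a time, each at a
    cost of at most [t ^ 2]. *)
Lemma prod3_sub_le (R : realFieldType) (t a b c a' b' c' : R) :
  0 <= a -> a <= a' <= t -> a' - 1 <= a -> 0 <= b -> b <= b' <= t -> b' - 1 <= b ->
  0 <= c -> c <= c' <= t -> c' - 1 <= c ->
  a' * b' * c' - 3 * t ^+ 2 <= a * b * c.
Proof.
move=> a0 /andP[aa' a't] a1 b0 /andP[bb' b't] b1 c0 /andP[cc' c't] c1.
have t0 : 0 <= t by lra.
have h1 : (a' - a) * (b' * c') <= 1 * (t * t).
  by rewrite !ler_pM ?mulr_ge0 //; lra.
have h2 : (b' - b) * (a * c') <= 1 * (t * t).
  by rewrite !ler_pM ?mulr_ge0 //; lra.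
have h3 : (c' - c) * (a * b) <= 1 * (t * t).
  by rewrite !ler_pM ?mulr_ge0 //; lra.
rewrite expr2; nra.
Qed.

Lemma exists_dense_blowup (R : realType) (P : finType) (G : {set P * P * P})
    (x : P -> R) (b : R) (N : nat) (GP : represents_3graph G) :
  (forall p, 0 <= x p) -> \sum_p x p = 1 -> 0 <= b -> b < 6 * lagrangian G x ->
  exists (T : finType) (k : T -> P) (U : {set T}),
    (N <= #|U|)%N /\ b <= density R (blowup_graph k GP U).
Proof.
move=> x0 x1 b0 bG; pose e := 6 * lagrangian G x - b.
have e0 : 0 < e by rewrite subr_gt0.
(* Rounding loses at most one vertex per class, whence [N + 3 + #|P|]; the last summand makes the
   gain [e * t ^ 3 / 6] cover the rounding loss [3 * #|G| * t ^ 2]. *)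
pose t := (N + 3 + #|P| + (Num.truncn (18 * #|G|%:R / e)).+1)%N.
have t_e : 18 * #|G|%:R <= e * t%:R.
  rewrite -ler_pdivrMl // [_^-1 * _]mulrC ltW // (lt_le_trans (truncnS_gt _)) //.
  by rewrite ler_nat leq_addl.
have t0 : 0 < t%:R :> R by rewrite ltr0n /t addnS.
pose n p := Num.truncn (x p * t%:R).
have n_le p : (n p)%:R <= x p * t%:R by rewrite truncn_le mulr_ge0.
have n_ge p : x p * t%:R - 1 <= (n p)%:R.
  by rewrite lerBlDr natr1 ltW // truncnS_gt.
have xt p : x p * t%:R <= t%:R.
  rewrite ger_pMl // -x1 (bigD1 p) //= lerDl; exact: sumr_ge0.
have nt p : (n p <= t)%N by rewrite -(ler_nat R) (le_trans (n_le p)).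
pose U := [set v : P * 'I_t | (v.2 < n v.1)%N].
exists (P * 'I_t)%type, (@fst P 'I_t), U.
have fiber p : #|[set v in U | v.1 == p]| = n p.
  have -> : [set v in U | v.1 == p] = [set (p, widen_ord (nt p) i) | i : 'I_(n p)].
    apply/setP => -[q j]; rewrite !inE /=; apply/andP/imsetP.
      case=> jn /eqP qp; subst q; exists (Ordinal jn) => //.
      by congr pair; apply: val_inj.
    by case=> i _ [-> ->]; rewrite eqxx /=.
  by rewrite card_imset ?card_ord // => i j [/val_inj].
have cardU : #|U| = (\sum_p n p)%N.
  by rewrite -(sum_card_fibers (@fst P 'I_t)); apply: eq_bigr => p _.
have sum_xt : \sum_p x p * t%:R = t%:R by rewrite -mulr_suml x1 mul1r.
have U_le : (#|U| <= t)%N.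
  rewrite cardU -(ler_nat R) natr_sum -sum_xt.
  by apply: ler_sum => p _.
have U_ge : (t <= #|U| + #|P|)%N.
  rewrite cardU -(ler_nat R) natrD natr_sum -sum_xt.
  rewrite -[X in _ + X]sumr_const -big_split; apply: ler_sum => p _ /=.
  by rewrite -lerBlDr.
have U_N3 : (N + 3 <= #|U|)%N.
  by rewrite -(leq_add2r #|P|) (leq_trans _ U_ge) // leq_addr.
split; first exact: leq_trans (leq_addr 3 N) U_N3.
have U3 : (3 <= #|U|)%N := leq_trans (leq_addl N 3) U_N3.
rewrite density3E card_blowup_edges /graph_order /=.
rewrite ler_pdivlMr ?ltr0n ?bin_gt0 //.
have b_bin : b * 'C(#|U|, 3)%:R <= b * (t%:R ^+ 3 / 6).
  rewrite ler_wpM2l // ler_pdivlMr // -natrM -natrX ler_nat bin3_mul6.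
  by rewrite !expnS expn0 muln1 mulnA !leq_mul // (leq_trans _ U_le) //; lia.
apply: le_trans b_bin _.
have : t%:R ^+ 3 * lagrangian G x - 3 * #|G|%:R * t%:R ^+ 2
    <= #|blowup (@fst P 'I_t) G U|%:R.
  rewrite card_blowup natr_sum -lagrangianZ /lagrangian.
  rewrite (_ : 3 * #|G|%:R * t%:R ^+ 2 = \sum_(s in G) 3 * t%:R ^+ 2); last first.
    by rewrite sumr_const -mulr_natl; ring.
  rewrite -sumrB; apply: ler_sum => s _.
  rewrite !fiber !natrM; apply: prod3_sub_le => //;
    by rewrite 1?mulrC ?n_le ?xt // mulrC n_ge.
apply: le_trans.
have : 0 <= t%:R ^+ 2 * (e * t%:R - 18 * #|G|%:R) by rewrite mulr_ge0 ?sqr_ge0 ?subr_ge0.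
rewrite /e; lra.
Qed.

(** The ratio of [m ^ 3 / 6] to ['C(m, 3)] tends to 1; this turns a Lagrangian bound into a density
    bound at one fixed order. *)
Lemma exists_large_binomial_ratio (R : realType) (a d : R) :
  0 <= a -> 0 < d ->
  exists m : nat, (3 <= m)%N /\ a * m%:R ^+ 3 / 6 < (a + d) * 'C(m, 3)%:R.
Proof.
(* Since [6 * 'C(m, 3) >= m ^ 3 - 3 * m ^ 2], it suffices that [d * m > 3 * (a + d)]. *)
move=> a0 d0; pose m := (Num.truncn (3 * (a + d) / d)).+3.
exists m; split=> //.
have : 3 * (a + d) < d * m%:R.
  rewrite -ltr_pdivrMl // [_^-1 * _]mulrC (lt_trans (truncnS_gt _)) //.
  by rewrite ltr_nat; apply: leqnSn.
have : 'C(m, 3)%:R * 6 = m%:R * (m%:R - 1) * (m%:R - 2) :> R.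
  by rewrite -natrM bin3_mul6 !natrM -subn2 -subn1 !natrB.
have : 0 < m%:R :> R by rewrite ltr0n.
move: (m%:R) ('C(m, 3)%:R) => M B M0 BE lt.
have -> : B = M * (M - 1) * (M - 2) / 6 by lra.
have : 0 < M ^+ 2 * (d * M - 3 * (a + d)) by rewrite mulr_gt0 ?exprn_gt0 // subr_gt0.
have : 0 <= (a + d) * M by rewrite mulr_ge0 ?addr_ge0 // ltW.
lra.
Qed.

(** The gap [d] of a supposed jump fixes the order [m] first; the pattern, and with it [e], is
    chosen afterwards. Its large blow-ups have density at least [a + e], yet no subgraph of order
    [m] reaches [a + d]. *)
Lemma non_jump_of_patterns (R : realType) (a : R) :
  0 <= a < 1 ->
  (forall m : nat, exists (P : finType) (G : {set P * P * P}),
     [/\ represents_3graph G,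
      exists x : P -> R,
        [/\ forall p, 0 <= x p, \sum_p x p = 1 & a < 6 * lagrangian G x] &
      forall u : P -> R, (forall p, 0 <= u p) -> \sum_p u p = 1 ->
        (#|[set p | u p != 0%R]| <= m)%N -> 6 * lagrangian G u <= a]) ->
  non_jump 3 a.
Proof.
move=> a01 pat; split=> // -[_ [d [d0 jmp]]].
have [a0 _] := andP a01.
have [m [m3 m_lt]] := exists_large_binomial_ratio a0 d0.
have [P [G [GP [x [x0 x1 xG]] Gm]]] := pat m.
pose e := (6 * lagrangian G x - a) / 2.
have e0 : 0 < e by rewrite divr_gt0 // subr_gt0.
have [N NG] := jmp e m e0 m3.
have [||T [k [U [UN Ud]]]] := @exists_dense_blowup R P G x (a + e) N GP x0 x1.
- by rewrite addr_ge0 // ltW.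
- by rewrite /e; lra.
have [H [HG Hm Hd]] := NG T (blowup_graph k GP U) UN Ud.
have : #|edges H|%:R <= a / 6 * m%:R ^+ 3.
  apply: card_subgraph_blowup_le HG Hm _; last exact: leq_trans m3.
  by move=> u u0 u1 um; have := Gm u u0 u1 um; lra.
move: Hd; rewrite density3E Hm ler_pdivlMr ?ltr0n ?bin_gt0 //.
lra.
Qed.

(** * Polynomial bounds *)

Lemma cubic_peak_le (R : realFieldType) (y : R) :
  0 <= y <= 1 -> y / 2 * (1 - y) ^+ 2 <= 2 / 27.
Proof.
move=> /andP[y0 y1].
(* The deficit is half this product, with a double root at the maximizer. *)
have : 0 <= (y - 1 / 3) ^+ 2 * (4 / 3 - y) by rewrite mulr_ge0 ?sqr_ge0 //; lra.
lra.
Qed.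

Lemma peak_le (R : realFieldType) (r y : R) :
  0 <= r -> r ^+ 2 = 5 -> 2 * y <= 1 ->
  y / 2 * (1 - y) ^+ 2 + ((1 - 2 * y) / 3) ^+ 3 <= (5 * r - 2) / 121.
Proof.
move=> r0 r2 y1; have r3 : r ^+ 3 = 5 * r by rewrite exprSr r2.
have ry : r ^+ 2 * y = 5 * y by rewrite r2.
(* The deficit is [11 / 54] times this product: a double root at the maximizer, and a third root
   above [1 / 2]. *)
have : 0 <= (y - (10 - 3 * r) / 11) ^+ 2 * ((10 + 6 * r) / 11 - y).
  by rewrite mulr_ge0 ?sqr_ge0 //; lra.
lra.
Qed.

(** The terms [(s - y) * a * b] and [g] help only if [s > y] and [a > y] respectively. If at most
    one does, [cubic_peak_le] or [peak_le] suffices; if both do, there is room to spare and a cruder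
    cubic bound works. *)
Lemma pattern_polynomial_le (R : realFieldType) (r y s a b g : R) :
  0 <= r -> r ^+ 2 = 5 ->
  0 <= y -> 0 <= s -> 0 <= a -> 0 <= b -> y + s + a + b = 1 ->
  (forall c, 0 <= c -> a <= y + c -> g <= (c / 3) ^+ 3) ->
  y / 2 * (1 - y) ^+ 2 + (s - y) * a * b + g <= (5 * r - 2) / 121.
Proof.
move=> r0 r2 y0 s0 a0 b0 sum1 gle.
(* This estimate of the square root of 5 serves the first and last cases, where the bound is not
   attained. *)
have r_ge : 559 / 250 <= r by nra.
have [ay|ya] := lerP a y; have [sy|ys] := lerP s y.
- have g0 : g <= 0 by have := gle 0 (lexx 0); rewrite mul0r expr0n addr0 => /(_ ay).
  have : (s - y) * a * b <= 0 by rewrite -mulrA mulr_le0_ge0 ?mulr_ge0 // subr_le0.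
  have := @cubic_peak_le R y; rewrite y0 /=; lra.
- have g0 : g <= 0 by have := gle 0 (lexx 0); rewrite mul0r expr0n addr0 => /(_ ay).
  have := @amgm3 R (s - y) a b; rewrite subr_ge0 (ltW ys) => /(_ isT a0 b0).
  have -> : s - y + a + b = 1 - 2 * y by lra.
  have := @peak_le R r y r0 r2; lra.
- have /gle : 0 <= a - y by lra.
  rewrite addrC subrK => /(_ (lexx a)) g0.
  have : ((a - y) / 3) ^+ 3 <= ((1 - 2 * y) / 3) ^+ 3 by rewrite lerXn2r ?nnegrE; lra.
  have : (s - y) * a * b <= 0 by rewrite -mulrA mulr_le0_ge0 ?mulr_ge0 // subr_le0.
  have := @peak_le R r y r0 r2; lra.
have /gle : 0 <= a - y by lra.
rewrite addrC subrK => /(_ (lexx a)) g0.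
pose A := a - y; pose t := (s - y + b) / 2.
have A0 : 0 <= A by rewrite subr_ge0 ltW.
have t0 : 0 <= t by rewrite /t; lra.
have Sb : (s - y) * b <= t ^+ 2.
  have := sqr_ge0 (s - y - b); rewrite /t; lra.
(* The ratio of the left side to [(A + 2 * t) ^ 3] peaks at about 1.042, near [A = 8 / 7 * t]. *)
have hom : A ^+ 3 + 27 * t ^+ 2 * A <= 21 / 20 * (A + 2 * t) ^+ 3.
  have : 0 <= t * ((A - 8 / 7 * t) ^+ 2 * (63 / 10) + 6 / 35 * t ^+ 2).
    rewrite mulr_ge0 //; have := sqr_ge0 t; have := sqr_ge0 (A - 8 / 7 * t); lra.
  have : 0 <= A ^+ 3 by rewrite exprn_ge0.
  lra.
have At : A + 2 * t = 1 - 3 * y by rewrite /A /t; lra.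
have t_le : t ^+ 2 <= ((1 - 3 * y) / 2) ^+ 2 by rewrite lerXn2r ?nnegrE; lra.
have yt_le : y * t ^+ 2 <= y * ((1 - 3 * y) / 2) ^+ 2 by rewrite ler_wpM2l.
have Sba : a * ((s - y) * b) <= a * t ^+ 2 by rewrite ler_wpM2l.
have aE : a * t ^+ 2 = y * t ^+ 2 + t ^+ 2 * A by rewrite /A; ring.
rewrite At in hom.
(* With [t] eliminated, the bound is a cubic in [y] whose local maximum, at [4 / 17], stays below
   the right side; [13 / 34] is the other point where it takes that value. *)
have : 0 <= (y - 4 / 17) ^+ 2 * (13 / 34 - y) by rewrite mulr_ge0 ?sqr_ge0 //; lra.
move: g0; rewrite -/A; lra.
Qed.

(** * The pattern *)

Lemma card_triple_set_le (T : finType) (t : T * T * T) : (#|triple_set t| <= 3)%N.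
Proof.
rewrite /triple_set (leq_trans (leq_card_setU _ _)) //.
by rewrite cards1 cards2; case: eqP.
Qed.

Section Pattern.
Variables (N : nat) (H : {set 'I_N * 'I_N * 'I_N}).
Local Notation P := ('I_4 * 'I_N)%type.

Definition cls (p : P) : nat := p.1.
Definition layer (c : nat) (i : 'I_N) : P := (inord c, i).
(** An arbitrary linear order, in which a base triple lists its last two vertices, so that each
    3-set arises once. *)
Definition before (p q : P) : bool := (enum_rank p < enum_rank q)%N.

Definition linked (p q : P) : bool :=
  [&& cls p != 0, cls q != 0, ~~ ((cls p == 2) && (cls q == 3))
    & ~~ ((cls p == 3) && (cls q == 2))]%N.

Definition base_triples : {set P * P * P} :=
  [set t | [&& cls t.1.1 == 0%N, linked t.1.2 t.2 & before t.1.2 t.2]].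

Definition cross_triples : {set P * P * P} :=
  [set t | [&& cls t.1.1 == 1%N, cls t.1.2 == 2%N & cls t.2 == 3%N]].

Definition sparse_triples : {set P * P * P} := [set map3 (layer 2) t | t in H].

(** Every layer has [N] vertices, so that with equal weights the loss from pairs inside a vertex is
    only [O(1 / N)]. *)
Definition pattern : {set P * P * P} :=
  base_triples :|: (cross_triples :|: sparse_triples).

Lemma cls_layer (c : nat) (i : 'I_N) : (c < 4)%N -> cls (layer c i) = c.
Proof. by move=> c4; rewrite /cls /= inordK. Qed.

Lemma layer_inj (c : nat) : injective (layer c).
Proof. by move=> i j []. Qed.

Lemma patternP (t : P * P * P) : t \in pattern ->
  [\/ [/\ cls t.1.1 = 0%N, cls t.1.2 <> 0%N, cls t.2 <> 0%N & before t.1.2 t.2],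
      [/\ cls t.1.1 = 1%N, cls t.1.2 = 2%N & cls t.2 = 3%N] |
      [/\ cls t.1.1 = 2%N, cls t.1.2 = 2%N, cls t.2 = 2%N & t \in sparse_triples]].
Proof.
rewrite !inE => /or3P[/and3P[/eqP c1 /and4P[/eqP c2 /eqP c3 _ _] bf]||].
- by constructor 1.
- by case/and3P => /eqP c1 /eqP c2 /eqP c3; constructor 2.
- move=> tH; constructor 3; case/imsetP: (tH) => s _ tE.
  by split=> //; rewrite tE cls_layer.
Qed.

(** The layers of the entries tell the three families apart and order the cross triples; [before]
    orders the base triples, and sparsity on 3 vertices excludes two triples of [H] on one 3-set. *)
Lemma pattern_represents :
  (forall S : {set 'I_N}, (#|S| <= 3)%N ->
     (#|[set t in H | within S t]| <= #|S| - 2)%N) ->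
  represents_3graph pattern.
Proof.
move=> sp.
have spH s : sparse_on H (triple_set s).
  move=> S /subset_leq_card le; apply: sp.
  exact: leq_trans le (card_triple_set_le s).
have H_inj : {in H &, injective (@triple_set _)}.
  move=> s t sH tH st; apply/eqP; apply: contraT => nst.
  have := sp _ (card_triple_set_le s); rewrite leqNgt => /negP[].
  apply: (@leq_trans #|[set s; t]|).
    by rewrite cards2 nst ltnS leq_subLR card_triple_set_le.
  apply/subset_leq_card/subsetP => u; rewrite in_set2 => /orP[] /eqP ->.
    by rewrite inE sH -triple_set_sub subxx.
  by rewrite inE tH -triple_set_sub st subxx.
split=> [[[a b] c] [[a' b'] c'] sG tG st|t tG].
{ have mem3 (u v : P * P * P) : triple_set u = triple_set v ->
      within [set v.1.1; v.1.2; v.2] u.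
    by move=> uv; rewrite -[X in within X]/(triple_set v) -triple_set_sub uv.
  move: (mem3 _ _ st) (mem3 _ _ (esym st)); rewrite /within !inE /=.
  move=> /and3P[s1t s2t s3t] /and3P[t1s _ _].
  have /= [[s1 s2 s3 bs]|[s1 s2 s3]|[s1 s2 s3 sH]] := patternP sG;
    have /= [[t1 t2 t3 bt]|[t1 t2 t3]|[t1 t2 t3 tH]] := patternP tG; last first.
  { case/imsetP: sH st => s' s'H ->; case/imsetP: tH => t' t'H -> st.
    congr map3; apply: H_inj => //; apply: (imset_inj (@layer_inj 2)).
    by rewrite !imset_triple_set. }
  all: case/orP: s1t => [/orP[]|] /eqP e1; case/orP: t1s => [/orP[]|] /eqP e1';
    try congruence.
  all: case/orP: s2t => [/orP[]|] /eqP e2; case/orP: s3t => [/orP[]|] /eqP e3;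
    try congruence.
  (* Apart from equal triples, there remain base triples with last two entries swapped or equal,
     against [before]. *)
  all: first [congruence | subst; move: bs bt; rewrite /before; lia]. }
have [[t1 t2 t3 bt]|[t1 t2 t3]|[_ _ _ /imsetP[s sH ->]]] := patternP tG; last first.
- rewrite -imset_triple_set (card_imset _ (@layer_inj 2)).
  have ws : within (triple_set s) s by rewrite -triple_set_sub.
  have /and3P[] := sparse_on_distinct (spH s) sH ws.
  exact: card_triple_set_uniq.
- by apply: card_triple_set_uniq; apply/eqP => /(congr1 cls); rewrite ?t1 ?t2 ?t3.
- apply: card_triple_set_uniq; apply/eqP.
  + by move=> /(congr1 cls); rewrite t1 => /esym.
  + by move=> /(congr1 cls); rewrite t1 => /esym.
  + by move=> e; move: bt; rewrite e /before ltnn.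
Qed.
End Pattern.

(** * The Lagrangian of the pattern *)

Lemma sum_before (R : realFieldType) (N : nat)
    (F : 'I_4 * 'I_N -> 'I_4 * 'I_N -> R) :
  (forall p q, F p q = F q p) ->
  2 * \sum_p \sum_q (if before p q then F p q else 0) =
    \sum_p \sum_q F p q - \sum_p F p p.
Proof.
move=> Fsym; set B := \sum_p _.
have -> : \sum_p \sum_q F p q = B + (B + \sum_p F p p).
  rewrite /B [X in _ + (X + _)]exchange_big -!big_split; apply: eq_bigr => p _ /=.
  have -> : F p p = \sum_q (if q == p then F p q else 0).
    by rewrite -big_mkcond big_pred1_eq.
  rewrite -!big_split /=.
  apply: eq_bigr => q _; rewrite /before (Fsym q p) -(inj_eq enum_rank_inj).
  rewrite -(inj_eq val_inj) /=.
  by case: ltngtP => _; rewrite ?(addr0, add0r).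
by ring.
Qed.

Lemma lagrangianU (R : realFieldType) (P : finType) (A B : {set P * P * P})
    (x : P -> R) :
  [disjoint A & B] -> lagrangian (A :|: B) x = lagrangian A x + lagrangian B x.
Proof.
move=> dAB; rewrite /lagrangian -bigU //=.
by apply: eq_bigl => t; rewrite !inE.
Qed.

Lemma sum_triples (R : nmodType) (T : finType) (F : T * T * T -> R) :
  \sum_t F t = \sum_p \sum_q \sum_r F (p, q, r).
Proof. by rewrite pair_bigA pair_bigA; apply: eq_bigr => -[[]]. Qed.

Lemma sum_layer (R : nmodType) (N c : nat) (f : 'I_4 * 'I_N -> R) :
  (c < 4)%N ->
  \sum_p (if cls p == c then f p else 0) = \sum_i f (layer c i).
Proof.
move=> c4; rewrite -big_mkcond /= (reindex_onto (@layer N c) snd) /=.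
  by apply: eq_bigl => i; rewrite cls_layer // !eqxx.
move=> [d i] /eqP /= dc; rewrite /layer; congr pair.
by apply: val_inj; rewrite /= inordK.
Qed.

Lemma sum_by_layers (R : nmodType) (N : nat) (f : 'I_4 * 'I_N -> R) :
  \sum_p f p = \sum_i f (layer 0 i) + \sum_i f (layer 1 i)
    + \sum_i f (layer 2 i) + \sum_i f (layer 3 i).
Proof.
rewrite -!sum_layer // -!big_split; apply: eq_bigr => -[[[|[|[|[|//]]]] lt] i] _ /=;
  by rewrite /cls /= ?(addr0, add0r).
Qed.

Section PatternLagrangian.
Variables (R : realFieldType) (N : nat) (H : {set 'I_N * 'I_N * 'I_N}).
Variable x : 'I_4 * 'I_N -> R.

Let S (c : nat) := \sum_i x (layer c i).
Let Q (c : nat) := \sum_i x (layer c i) ^+ 2.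
Let w (c : nat) p := if cls p == c then x p else 0.

Lemma lagrangian_base_triples :
  lagrangian (@base_triples N) x =
    S 0 / 2 * ((S 1 + S 2 + S 3) ^+ 2 - (Q 1 + Q 2 + Q 3)) - S 0 * S 2 * S 3.
Proof.
pose W p := w 1 p + w 2 p + w 3 p.
(* [F p q] is [x p * x q] on linked pairs and 0 elsewhere; its diagonal yields the squares. *)
pose F p q := W p * W q - w 2 p * w 3 q - w 3 p * w 2 q.
have -> : lagrangian (@base_triples N) x =
    S 0 * (\sum_p \sum_q (if before p q then F p q else 0)).
  rewrite /lagrangian big_mkcond sum_triples /S -sum_layer // mulr_suml.
  apply: eq_bigr => p _; rewrite mulr_sumr; apply: eq_bigr => q _.
  rewrite mulr_sumr; apply: eq_bigr => r _ /=.
  rewrite inE /= /linked /F /W /w; case: (cls p == 0%N); rewrite /= ?mul0r //.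
  case: (before q r); rewrite ?andbF ?mulr0 // andbT -mulrA.
  case: q => [[[|[|[|[|//]]]] ltq] i]; case: r => [[[|[|[|[|//]]]] ltr] j];
    by rewrite /cls /=; ring.
have SW : \sum_p W p = S 1 + S 2 + S 3.
  by rewrite /W !big_split /= !sum_layer.
have sumF : \sum_p \sum_q F p q = (S 1 + S 2 + S 3) ^+ 2 - 2 * S 2 * S 3.
  under eq_bigr do rewrite !sumrB.
  rewrite !sumrB -!big_distrlr /= SW !sum_layer // -/(S 2) -/(S 3); ring.
have sumFd : \sum_p F p p = Q 1 + Q 2 + Q 3.
  rewrite sum_by_layers /F /W /w big1 ?add0r; last first.
    by move=> i _; rewrite cls_layer //=; ring.
  by congr (_ + _ + _); apply: eq_bigr => i _; rewrite cls_layer //=; ring.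
have Fsym p q : F p q = F q p by rewrite /F; ring.
have := sum_before Fsym; rewrite sumF sumFd; set B := \sum_p _ => BE.
suff -> : B = ((S 1 + S 2 + S 3) ^+ 2 - 2 * S 2 * S 3 - (Q 1 + Q 2 + Q 3)) / 2 by field.
by lra.
Qed.

Lemma lagrangian_cross_triples :
  lagrangian (@cross_triples N) x = S 1 * S 2 * S 3.
Proof.
rewrite /lagrangian big_mkcond sum_triples /S -!sum_layer // !mulr_suml.
apply: eq_bigr => p _; rewrite -mulrA big_distrlr mulr_sumr /=.
apply: eq_bigr => q _; rewrite mulr_sumr; apply: eq_bigr => r _.
rewrite inE /=; case: (cls p == _); case: (cls q == _); case: (cls r == _) => /=;
  by rewrite ?(mul0r, mulr0) // mulrA.
Qed.

Lemma lagrangian_sparse_triples :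
  lagrangian (sparse_triples H) x = lagrangian H (fun i => x (layer 2 i)).
Proof.
rewrite /lagrangian /sparse_triples big_imset //=.
by move=> [[a b] c] [[a' b'] c'] _ _ [-> -> ->].
Qed.

Lemma lagrangian_pattern :
  lagrangian (pattern H) x =
    S 0 / 2 * ((S 1 + S 2 + S 3) ^+ 2 - (Q 1 + Q 2 + Q 3))
    + (S 1 - S 0) * S 2 * S 3 + lagrangian H (fun i => x (layer 2 i)).
Proof.
have d1 : [disjoint @cross_triples N & sparse_triples H].
  apply/pred0P => t /=; apply/negP => /andP[].
  rewrite inE => /and3P[/eqP c1 _ _] /imsetP[s _ tE].
  by move: c1; rewrite tE cls_layer.
have d2 : [disjoint @base_triples N & @cross_triples N :|: sparse_triples H].
  apply/pred0P => t /=; apply/negP => /andP[]; rewrite !inE => /and3P[/eqP c0 _ _].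
  rewrite c0 /= => /imsetP[s _ tE].
  by move: c0; rewrite tE cls_layer.
rewrite !lagrangianU // lagrangian_base_triples lagrangian_cross_triples.
by rewrite lagrangian_sparse_triples; ring.
Qed.

End PatternLagrangian.

(** The squares of layer 2 offset [H] as in [sparse_lagrangian_le]; those of layers 1 and 3 only
    lower the value and are dropped. *)
Lemma lagrangian_pattern_le (R : realFieldType) (r : R) (N m : nat)
    (H : {set 'I_N * 'I_N * 'I_N}) (x : 'I_4 * 'I_N -> R) :
  0 <= r -> r ^+ 2 = 5 ->
  (forall S : {set 'I_N}, (#|S| <= m)%N ->
     (#|[set t in H | within S t]| <= #|S| - 2)%N) ->
  (forall p, 0 <= x p) -> \sum_p x p = 1 -> (#|[set p | x p != 0%R]| <= m)%N ->
  lagrangian (pattern H) x <= (5 * r - 2) / 121.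
Proof.
move=> r0 r2 sp x0; rewrite sum_by_layers lagrangian_pattern => sum1 xm.
pose z i := x (layer 2 i).
have spz : sparse_on H [set i | z i != 0].
  move=> A AS; apply: sp; apply: leq_trans xm.
  rewrite -(card_imset _ (@layer_inj N 2)) subset_leq_card //.
  apply/subsetP => _ /imsetP[i iA ->]; rewrite inE.
  by have := subsetP AS i iA; rewrite inE.
have S0 c : 0 <= \sum_i x (layer c i) by apply: sumr_ge0.
have Q0 c : 0 <= \sum_i x (layer c i) ^+ 2 by apply: sumr_ge0 => i _; rewrite sqr_ge0.
have := pattern_polynomial_le r0 r2 (S0 0%N) (S0 1%N) (S0 2%N) (S0 3%N) sum1
  (g := lagrangian H z - (\sum_i x (layer 0 i)) / 2 * \sum_i z i ^+ 2)
  (fun c c0 ac => sparse_lagrangian_le (fun i => x0 _) spz (S0 0%N) c0 ac).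
apply: le_trans.
set y := \sum_i x (layer 0 i) in sum1 *.
rewrite (_ : _ + _ + \sum_i x (layer 3 i) = 1 - y); last by lra.
have : 0 <= y / 2 * (\sum_i x (layer 1 i) ^+ 2 + \sum_i x (layer 3 i) ^+ 2).
  by rewrite !(mulr_ge0, addr_ge0) ?invr_ge0 ?Q0 ?S0.
rewrite /z; lra.
Qed.

(* At the optimal layer weights, spread uniformly inside each layer, the pattern
   without [H] falls short of the bound by [O(1 / N)]; [20 * N ^ 2] triples in
   [H] more than compensate for it. *)
Lemma lagrangian_pattern_gt (R : realFieldType) (r : R) (N : nat)
    (H : {set 'I_N * 'I_N * 'I_N}) :
  0 <= r -> r ^+ 2 = 5 -> (0 < N)%N -> (20 * N ^ 2 <= #|H|)%N ->
  exists x : 'I_4 * 'I_N -> R, [/\ forall p, 0 <= x p, \sum_p x p = 1 &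
    (5 * r - 2) / 121 < lagrangian (pattern H) x].
Proof.
move=> r0 r2 N0 HN; have r3 : r ^+ 3 = 5 * r by rewrite exprSr r2.
have r_ge : 559 / 250 <= r by nra.
have r_le : r <= 2237 / 1000 by nra.
(* The optimal weights: [y] is the maximizer of [peak_le], and equality in AM-GM forces
   [s - y = a = b]. *)
pose y := (10 - 3 * r) / 11; pose s := (7 - r) / 11; pose a := (2 * r - 3) / 11.
pose v c := nth 0 [:: y; s; a; a] c.
pose M : R := N%:R; have M0 : 0 < M by rewrite ltr0n.
pose x (p : 'I_4 * 'I_N) := v (cls p) / M.
have S_ c : (c < 4)%N -> \sum_i x (layer c i) = v c.
  move=> c4; rewrite (eq_bigr (fun=> v c / M)) => [|i _]; last by rewrite /x cls_layer.
  by rewrite sumr_const card_ord -mulr_natr divfK ?gt_eqF.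
have Q_ c : (c < 4)%N -> \sum_i x (layer c i) ^+ 2 = v c ^+ 2 / M.
  move=> c4; rewrite (eq_bigr (fun=> (v c / M) ^+ 2)) => [|i _]; last by rewrite /x cls_layer.
  by rewrite sumr_const card_ord -mulr_natr -/M; field; rewrite gt_eqF.
exists x; split.
- move=> [[[|[|[|[|//]]]] lt] i]; rewrite /x /cls /= divr_ge0 // ?ltW // /v /= /y /s /a; lra.
- by rewrite sum_by_layers !S_ // /v /= /y /s /a; lra.
rewrite lagrangian_pattern !S_ // !Q_ // /v /=.
have -> : lagrangian H (fun i => x (layer 2 i)) = #|H|%:R * (a / M) ^+ 3.
  rewrite /lagrangian (eq_bigr (fun=> (a / M) ^+ 3)) => [|t _].
    by rewrite sumr_const mulr_natl.
  by rewrite /x !cls_layer // !exprS expr0 mulr1 mulrA.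
have a0 : 0 < a by rewrite /a; lra.
have H_ge : 20 * a ^+ 3 / M <= #|H|%:R * (a / M) ^+ 3.
  have -> : 20 * a ^+ 3 / M = 20 * M ^+ 2 * (a / M) ^+ 3 by field; rewrite gt_eqF.
  apply: ler_wpM2r; first by rewrite exprn_ge0 // ltW // divr_gt0.
  by rewrite /M -natrX -natrM ler_nat.
apply: lt_le_trans (lerD (lexx _) H_ge).
rewrite -subr_gt0.
have -> : y / 2 * ((s + a + a) ^+ 2 - (s ^+ 2 / M + a ^+ 2 / M + a ^+ 2 / M))
  + (s - y) * a * a + 20 * a ^+ 3 / M - (5 * r - 2) / 121
  = (y / 2 * (s + a + a) ^+ 2 + (s - y) * a * a - (5 * r - 2) / 121)
    + (20 * a ^+ 3 - y / 2 * (s ^+ 2 + 2 * a ^+ 2)) / M by field; rewrite gt_eqF.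
have -> : y / 2 * (s + a + a) ^+ 2 + (s - y) * a * a - (5 * r - 2) / 121 = 0.
  by rewrite /y /s /a; lra.
(* Here [20 * a ^ 3] is about 0.048, against a loss of about 0.033. *)
rewrite add0r divr_gt0 // /y /s /a; lra.
Qed.

Theorem theorem1p3 (R : realType) :
  non_jump 3 (6 / 121 * (5 * Num.sqrt 5 - 2) : R).
Proof.
set r := Num.sqrt 5; have r0 : 0 <= r by apply: sqrtr_ge0.
have r2 : r ^+ 2 = 5 by rewrite sqr_sqrtr.
have aE : 6 / 121 * (5 * r - 2) = 6 * ((5 * r - 2) / 121) by ring.
apply: non_jump_of_patterns => [|m].
  by apply/andP; split; nra.
(* The extra 3 gives sparsity on 3-sets, as [pattern_represents] asks, for every [m]. *)
have [N [H [N0 HN sp]]] := exists_locally_sparse (m + 3) 20.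
have [x [x0 x1 xH]] := lagrangian_pattern_gt r0 r2 N0 HN.
exists ('I_4 * 'I_N)%type, (pattern H); split.
- by apply: pattern_represents => S S3; apply: sp; rewrite (leq_trans S3) ?leq_addl.
- by exists x; split=> //; rewrite aE ltr_pM2l.
move=> u u0 u1 um; rewrite aE ler_pM2l //.
apply: lagrangian_pattern_le sp u0 u1 _ => //.
by rewrite (leq_trans um) ?leq_addr.
Qed.
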